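(* Let $\mathbb{F}$ be a finite field with $q > 2$ elements, let $t := \frac{q-1}{q-2}$, and let $S \subseteq \mathbb{F} \setminus \{0\}$. There is an algorithm that, given $M, N \in \mathbb{N}$ and a polynomial $p \in \mathbb{F}[X_1, \ldots, X_N]$ that is the sum of at most $M$ monomials, decides whether $p(\mathbf{s}) = 0$ for all $\mathbf{s} \in S^N$ and uses at most \[ \max\left(1, \binom{N}{\lfloor \log_t(M) \rfloor} \right) \cdot |S|^{\lfloor \log_t(M) \rfloor} \] evaluations of $p$.
   Context: $\mathbb{N}$ denotes the set of positive integers. Here $p$ being the sum of at most $M$ monomials means that at most $M$ monomials $X_1^{e_1}\cdots X_N^{e_N}$ appear in $p$ with nonzero coefficient; no degree bound on $p$ is assumed. The binomial coefficient $\binom{N}{k}$ is $0$ if $k > N$. The algorithm is a black-box test: it accesses $p$ only through evaluations, i.e., it may query the value $p(\mathbf{a}) \in \mathbb{F}$ for points $\mathbf{a} \in \mathbb{F}^N$ of its choice, and it must output its decision based on $M$, $N$ and the values obtained. *)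

(* Defs.v *)
From HB Require Import structures.
From mathcomp Require Import all_boot all_order all_algebra.
From mathcomp Require Import reals exp.
From mathcomp Require Import mpoly.

Set Implicit Arguments.
Unset Strict Implicit.
Unset Printing Implicit Defensive.

Import Order.TTheory GRing.Theory Num.Theory.

Local Open Scope ring_scope.

(* The floor of log_b x.  [Num.truncn] is the floor on nonnegative reals (and
   0 on negative ones), so this is the usual value whenever 1 < b and 1 <= x. *)
Definition floor_log (R : realType) (b x : R) : nat :=
  Num.truncn (ln x / ln b).

(* Algorithms are programs of a deterministic, Turing-complete WHILE language.
   A machine has registers holding natural numbers and an addressable memory
   of cells holding field elements.  [Query e] evaluates the black-box
   polynomial in N variables at the point stored in the cells 0, ..., N-1 and
   writes the answer into the cell with address e; this is the only access a
   program has to the polynomial. *)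

Inductive nexpr : Type :=
| NReg of nat
| NConst of nat
| NAdd of nexpr & nexpr
| NSub of nexpr & nexpr
| NMul of nexpr & nexpr
| NDiv of nexpr & nexpr
| NMod of nexpr & nexpr.

Section Programs.

Variable F : finFieldType.

Inductive fexpr : Type :=
| FCell of nexpr
| FConst of F
| FAdd of fexpr & fexpr
| FOpp of fexpr
| FMul of fexpr & fexpr
| FInv of fexpr.

Inductive test : Type :=
| TLeq of nexpr & nexpr
| TFEq of fexpr & fexpr
| TNot of test
| TAnd of test & test.

Inductive prog : Type :=
| Skip
| SetReg of nat & nexpr
| SetCell of nexpr & fexpr
| Query of nexpr
| Seq of prog & prog
| If of test & prog & prog
| While of test & prog.

Record state : Type := State { reg : nat -> nat; cell : nat -> F }.

Definition set_reg (s : state) (x v : nat) : state :=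
  State [eta reg s with x |-> v] (cell s).

Definition set_cell (s : state) (i : nat) (a : F) : state :=
  State (reg s) [eta cell s with i |-> a].

Fixpoint neval (s : state) (e : nexpr) : nat :=
  match e with
  | NReg x => reg s x
  | NConst n => n
  | NAdd e1 e2 => (neval s e1 + neval s e2)%N
  | NSub e1 e2 => (neval s e1 - neval s e2)%N
  | NMul e1 e2 => (neval s e1 * neval s e2)%N
  | NDiv e1 e2 => (neval s e1 %/ neval s e2)%N
  | NMod e1 e2 => (neval s e1 %% neval s e2)%N
  end.

Fixpoint feval (s : state) (e : fexpr) : F :=
  match e with
  | FCell i => cell s (neval s i)
  | FConst a => a
  | FAdd e1 e2 => feval s e1 + feval s e2
  | FOpp e1 => - feval s e1
  | FMul e1 e2 => feval s e1 * feval s e2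
  | FInv e1 => (feval s e1)^-1
  end.

Fixpoint teval (s : state) (b : test) : bool :=
  match b with
  | TLeq e1 e2 => (neval s e1 <= neval s e2)%N
  | TFEq e1 e2 => feval s e1 == feval s e2
  | TNot b1 => ~~ teval s b1
  | TAnd b1 b2 => teval s b1 && teval s b2
  end.

Definition query_point (N : nat) (s : state) : {ffun 'I_N -> F} :=
  [ffun i : 'I_N => cell s i].

(* [exec f c s s' n]: started in the state s, the program c halts in the state
   s' after exactly n queries to the oracle f (repetitions included). *)
Inductive exec (N : nat) (f : {ffun 'I_N -> F} -> F) :
    prog -> state -> state -> nat -> Prop :=
| ExecSkip s : exec f Skip s s 0
| ExecSetReg x e s : exec f (SetReg x e) s (set_reg s x (neval s e)) 0
| ExecSetCell i e s :
    exec f (SetCell i e) s (set_cell s (neval s i) (feval s e)) 0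
| ExecQuery i s :
    exec f (Query i) s (set_cell s (neval s i) (f (query_point N s))) 1
| ExecSeq c1 c2 s s1 s2 n1 n2 :
    exec f c1 s s1 n1 -> exec f c2 s1 s2 n2 ->
    exec f (Seq c1 c2) s s2 (n1 + n2)
| ExecIfTrue b c1 c2 s s1 n :
    teval s b -> exec f c1 s s1 n -> exec f (If b c1 c2) s s1 n
| ExecIfFalse b c1 c2 s s1 n :
    ~~ teval s b -> exec f c2 s s1 n -> exec f (If b c1 c2) s s1 n
| ExecWhileTrue b c s s1 s2 n1 n2 :
    teval s b -> exec f c s s1 n1 -> exec f (While b c) s1 s2 n2 ->
    exec f (While b c) s s2 (n1 + n2)
| ExecWhileFalse b c s :
    ~~ teval s b -> exec f (While b c) s s 0.

Lemma exec_det (N : nat) (f : {ffun 'I_N -> F} -> F) c s s1 s2 n1 n2 :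
  exec f c s s1 n1 -> exec f c s s2 n2 -> s1 = s2 /\ n1 = n2.
Proof.
move=> H; elim: H s2 n2 => {c s s1 n1}.
- by move=> s s2 n2 H; inversion H.
- by move=> x e s s2 n2 H; inversion H.
- by move=> i e s s2 n2 H; inversion H.
- by move=> i s s2 n2 H; inversion H.
- move=> c1 c2 s s1 s2 n1 n2 _ IH1 _ IH2 s' n' H.
  inversion H as [| | | | ? ? ? t1 ? m1 m2 E1 E2 | | | |]; subst.
  by case: (IH1 _ _ E1) => ? ?; subst; case: (IH2 _ _ E2) => -> ->.
- move=> b c1 c2 s s1 n hb _ IH s' n' H.
  inversion H as [| | | | | ? ? ? ? ? ? h E | ? ? ? ? ? ? h E | |]; subst.
    exact: IH.
  by rewrite hb in h.
- move=> b c1 c2 s s1 n hb _ IH s' n' H.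
  inversion H as [| | | | | ? ? ? ? ? ? h E | ? ? ? ? ? ? h E | |]; subst.
    by rewrite h in hb.
  exact: IH.
- move=> b c s s1 s2 n1 n2 hb _ IH1 _ IH2 s' n' H.
  inversion H as [| | | | | | | ? ? ? t1 ? m1 m2 h E1 E2 | ? ? ? h]; subst.
    by case: (IH1 _ _ E1) => ? ?; subst; case: (IH2 _ _ E2) => -> ->.
  by rewrite hb in h.
- move=> b c s hb s' n' H.
  inversion H as [| | | | | | | ? ? ? t1 ? m1 m2 h E1 E2 | ? ? ? h]; subst => //.
  by rewrite h in hb.
Qed.

Definition init_state (M N : nat) : state :=
  State [eta fun=> 0%N with 0%N |-> M, 1%N |-> N] (fun=> 0).

(* On the input (M, N), with oracle f, the program c halts with the decision
   [ans] (register 0 is nonzero on exit iff the answer is "yes") after exactly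
   n queries. *)
Definition runs (c : prog) (M N : nat) (f : {ffun 'I_N -> F} -> F)
    (ans : bool) (n : nat) : Prop :=
  exists s : state, exec f c (init_state M N) s n /\ ans = (reg s 0 != 0%N).

Definition black_box (N : nat) (p : {mpoly F[N]}) : {ffun 'I_N -> F} -> F :=
  fun a => p.@[a].

End Programs.

(* Main.v *)
(* Fix a in S^N.  If p does not vanish on S^N, choose s in S^N with p(s) <> 0
   and consider the points mixing a and s: one at minimal distance d from a
   with p <> 0 satisfies t^d <= M.  Indeed p then vanishes whenever a proper
   subset of those d coordinates is moved, and eliminating one coordinate by
   a well-chosen linear combination of its two values divides the number of
   monomials by at least t, so that d eliminations leave at least one term.
   Hence it suffices to query the points of S^N that differ from a in at most
   k = floor(log_t M) coordinates; there are at most C(N, k) |S|^k of them if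
   k <= N and |S|^N otherwise.  The program enumerates all |S|^N points as
   base-|S| numbers, a being the zero digits, and queries only the points
   with at most k nonzero digits; it tests t^w <= M in integer arithmetic as
   (q - 1)^w <= M (q - 2)^w. *)

Require Import Defs.
From HB Require Import structures.
From mathcomp Require Import all_boot all_order all_algebra.
From mathcomp Require Import reals exp.
From mathcomp Require Import mpoly.
From mathcomp Require Import zify.

Set Implicit Arguments.
Unset Strict Implicit.
Unset Printing Implicit Defensive.

Import Order.TTheory GRing.Theory Num.Theory.

Local Open Scope ring_scope.


(** * Integer form of the logarithmic bound *)

Section FloorLog.

Variable R : realType.

Lemma leq_floor_log (b x : R) (j : nat) :
  1 < b -> 1 <= x -> (j <= floor_log b x)%N = (b ^+ j <= x).
Proof.
move=> b1 x1; have b0 : 0 < b by exact: lt_trans b1.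
have x0 : 0 < x by exact: lt_le_trans x1.
have lb : 0 < ln b by rewrite ln_gt0.
rewrite /floor_log truncn_ge_nat; last exact: divr_ge0 (ln_ge0 x1) (ltW lb).
by rewrite ler_pdivlMr // mulr_natl -lnXn // ler_ln ?posrE ?exprn_gt0.
Qed.

(** Clearing denominators, which are positive as q > 2, removes the reals, so that a program on
    natural numbers can make the comparison. *)
Lemma leq_floor_log_nat (q M j : nat) : (2 < q)%N -> (0 < M)%N ->
  (j <= floor_log ((q%:R - 1) / (q%:R - 2%:R) : R) M%:R)%N =
  (q.-1 ^ j <= M * q.-2 ^ j)%N.
Proof.
case: q => [|[|[|q]]] // _ M0 /=.
have -> : q.+3%:R - 1 = q.+2%:R :> R by rewrite -natr1 addrK.
have -> : q.+3%:R - 2%:R = q.+1%:R :> R by rewrite -addn2 natrD addrK.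
have q0 : 0 < q.+1%:R :> R by rewrite ltr0n.
rewrite leq_floor_log ?ler1n // ?ltr_pdivlMr ?mul1r ?ltr_nat //.
by rewrite expr_div_n ler_pdivrMr ?exprn_gt0 // -!natrX -natrM ler_nat.
Qed.

End FloorLog.

(** * Nonzero values of sparse polynomials near a base point *)

Section SparseNonvanishing.

Variable F : finFieldType.

(** Pigeonhole: [g] takes at most q - 1 values, all nonzero, and [a] is a most frequent one. *)
Lemma popular_unit_value (J : Type) (r : seq J) (g : J -> F) :
    (forall j, g j != 0) ->
  exists a : F, (size r <= #|F|.-1 * count (fun j => g j == a) r)%N.
Proof.
move=> g0; pose cnt a := count (fun j => g j == a) r.
have F1 : (1 : F) != 0 by exact: oner_neq0.
case: (@arg_maxnP _ 1 (fun a => a != 0) cnt F1) => a _ amax.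
exists a; rewrite -sum1_size (partition_big g (fun a => a != 0)) //=.
rewrite -(cardC1 (0 : F)) -sum_nat_const.
by apply: leq_sum => b b0; rewrite sum1_count; apply: amax.
Qed.

(* With [a] the most popular value of [z i], the combination H(E + i) - a H(E)
   kills the terms with [z i j = a], which are at least a fraction 1/(q-1) of
   all terms, and it has the same vanishing pattern on the subsets of D - i. *)
Lemma sparse_vanishing_size (I : finType) (J : Type) (z : I -> J -> F)
    (D : {set I}) (r : seq J) (c : J -> F) :
    (forall i j, z i j != 0) ->
    (forall E : {set I}, E \proper D ->
       \sum_(j <- r) c j * \prod_(i in E) z i j = 0) ->
    \sum_(j <- r) c j * \prod_(i in D) z i j != 0 ->
  (#|F|.-1 ^ #|D| <= size r * #|F|.-2 ^ #|D|)%N.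
Proof.
move=> z0; move Dd : #|D| => d.
elim: d D Dd r c => [|d IH] D Dd r c HE HD.
  rewrite !expn0 muln1 lt0n; apply: contraNneq HD => /size0nil->.
  by rewrite big_nil.
have [i iD] : exists i, i \in D by apply/card_gt0P; rewrite Dd.
have Dd' : #|D :\ i| = d by have := cardsD1 i D; rewrite iD Dd => -[].
have [a ha] := popular_unit_value r (z0 i).
pose r' := [seq j <- r | z i j != a].
pose c' j := c j * (z i j - a).
have H' (E : {set I}) : E \subset D :\ i ->
    \sum_(j <- r') c' j * \prod_(i in E) z i j =
    \sum_(j <- r) c j * \prod_(k in i |: E) z k j -
    a * \sum_(j <- r) c j * \prod_(i in E) z i j.
  move=> sE; have iE : i \notin E.
    by apply/negP => /(subsetP sE); rewrite !inE eqxx.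
  rewrite big_filter mulr_sumr -sumrB big_mkcond /=.
  apply: eq_bigr => j _; rewrite big_setU1 //= /c'.
  case: eqP => [-> | _] /=; first by rewrite mulrCA subrr.
  by rewrite mulrBr mulrBl !mulrA [c j * a]mulrC.
have prop (E : {set I}) : E \subset D :\ i -> E \proper D.
  by move=> sE; apply: sub_proper_trans sE (properD1 iD).
have := IH _ Dd' r' c'.
(* Since [D :\ i] is proper in [D], its old sum is zero, so its new sum is exactly the nonzero sum
   over [D]. *)
rewrite H' // (HE (D :\ i)) ?prop // mulr0 subr0 setD1K // => /(_ _ HD) IH'.
have {}IH' : (#|F|.-1 ^ d <= size r' * #|F|.-2 ^ d)%N.
  apply: IH' => E pE; have sE := proper_sub pE.
  have [sED [k kD kE]] := properP pE.
  have pE' : i |: E \proper D.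
    rewrite -(setD1K iD); apply/properP; split.
      exact: setUS.
    exists k; rewrite inE ?kD ?orbT // (negPf kE) orbF.
    by move: kD; rewrite !inE => /andP[].
  by rewrite H' // (HE _ pE') (HE _ (prop _ sE)) mulr0 subr0.
have sz : (#|F|.-1 * size r' <= #|F|.-2 * size r)%N.
  rewrite size_filter.
  have := count_predC (fun j => z i j == a) r; rewrite /predC /= => e.
  have q1 : (0 < #|F|.-1)%N by have := card_finRing_gt1 F; case: #|F| => [|[]].
  move: ha; rewrite -[X in (X <= _ -> _)%N]e -e -(prednK q1) /=.
  set u := count _ r; set v := count _ r; lia.
rewrite !expnS; apply: leq_trans (leq_mul (leqnn _) IH') _.
by rewrite !mulnA leq_mul2r [X in (_ <= X)%N]mulnC sz orbT.
Qed.

(** An inclusion-minimal [E] with a nonzero value at the mixed point has only zeros at its proper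
    subsets, which is the pattern required by [sparse_vanishing_size]. *)
Lemma sparse_nonvanishing_near (N : nat) (p : {mpoly F[N]})
    (a s : 'I_N -> F) :
    (forall i, a i != 0) -> (forall i, s i != 0) -> p.@[s] != 0 ->
  exists E : {set 'I_N},
    (#|F|.-1 ^ #|E| <= size (msupp p) * #|F|.-2 ^ #|E|)%N /\
    p.@[fun i => if i \in E then s i else a i] != 0.
Proof.
move=> a0 s0 ps; pose x (E : {set 'I_N}) i := if i \in E then s i else a i.
have [|E /minsetP[pE Emin]] := @ex_minset _ [pred E | p.@[x E] != 0].
  by exists setT; rewrite /= (meval_eq (v2 := s)) // => i; rewrite /x inE.
exists E; split=> //.
(* Moving coordinate [i] from [a] to [s] multiplies the monomial [m] by [z i m]; [c m] is the value
   of its term at [a]. *)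
pose z i (m : 'X_{1..N}) := (s i / a i) ^+ m i.
pose c (m : 'X_{1..N}) := p@_m * \prod_i a i ^+ m i.
have px A : p.@[x A] = \sum_(m <- msupp p) c m * \prod_(i in A) z i m.
  rewrite mevalE; apply: eq_bigr => m _; rewrite -mulrA; congr (_ * _).
  rewrite [X in _ = _ * X]big_mkcond -big_split /=; apply: eq_bigr => i _.
  rewrite /x /z; case: ifP => _; last by rewrite mulr1.
  by rewrite -exprMn mulrCA divff ?mulr1.
apply: (@sparse_vanishing_size _ _ z _ _ c).
- by move=> i m; rewrite expf_neq0 // mulf_neq0 ?invr_eq0.
- move=> A /properP[sA [i iE iA]]; rewrite -px; apply/eqP.
  by apply: contraNT iA => pA; rewrite (Emin A).
- by rewrite -px.
Qed.

End SparseNonvanishing.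

(** * Base-[m] digits and the number of codes of low weight *)

Section Digits.

Variable m : nat.

Definition digit (x i : nat) : nat := (x %/ m ^ i %% m)%N.

Definition digit_weight (x j : nat) : nat := \sum_(i < j) (digit x i != 0).

Lemma digit_inj (N x y : nat) : (x < m ^ N)%N -> (y < m ^ N)%N ->
  (forall i, (i < N)%N -> digit x i = digit y i) -> x = y.
Proof.
elim: N x y => [|N IH] x y; first by rewrite expn0 !ltnS !leqn0 => /eqP-> /eqP->.
case: (posnP m) => [->|m0]; first by rewrite exp0n.
rewrite expnSr -!ltn_divLR // => hx hy hxy.
rewrite (divn_eq x m) (divn_eq y m); congr (_ * _ + _)%N; last first.
  by have := hxy 0 isT; rewrite /digit expn0 !divn1.
apply: IH => // i iN.
by have := hxy i.+1 iN; rewrite /digit expnS !divnMA.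
Qed.

(** Lets supports of size at most [k] be enlarged to size exactly [k], so that only [k]-sets need
    counting. *)
Lemma superset_card (I : finType) (A : {set I}) (k : nat) :
    (#|A| <= k <= #|I|)%N ->
  exists2 B : {set I}, A \subset B & #|B| = k.
Proof.
elim: k => [|k IH] /andP[].
  by rewrite leqn0 => /eqP A0 _; exists A.
rewrite leq_eqVlt => /orP[/eqP Ak _|]; first by exists A.
rewrite ltnS => Ak kI; have [|B AB cB] := IH; first by rewrite Ak ltnW.
have [i iB] : exists i, i \in ~: B.
  by apply/card_gt0P; move: kI; rewrite -cB -(cardsC B) -[X in (X < _)%N]addn0 ltn_add2l.
exists (i |: B); first exact: subset_trans AB (subsetUr _ _).
by rewrite cardsU1 cB; move: iB; rewrite inE => ->.
Qed.

Lemma leq_card_bigcup (I J : finType) (P : pred J) (B : J -> {set I}) :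
  (#|\bigcup_(j | P j) B j| <= \sum_(j | P j) #|B j|)%N.
Proof.
elim/big_rec2: _ => [|j U n _ IH]; first by rewrite cards0.
by rewrite (leq_trans (leq_card_setU _ _).1) ?leq_add2l.
Qed.

Variable m_gt0 : (0 < m)%N.
Variable N : nat.

Definition code_digits (x : 'I_(m ^ N)) : {ffun 'I_N -> 'I_m} :=
  [ffun i : 'I_N => Ordinal (ltn_pmod (x %/ m ^ i) m_gt0)].

Lemma code_digits_bij : bijective code_digits.
Proof.
apply: inj_card_bij; last by rewrite card_ffun !card_ord.
move=> x y /ffunP exy; apply/val_inj/(digit_inj (ltn_ord x) (ltn_ord y)) => i iN.
by have := exy (Ordinal iN); rewrite !ffunE => -[].
Qed.

(** If [K <= N], at most [K] nonzero digits fit in a set of exactly [K] positions: there are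
    ['C(N, K)] such sets, each supporting [m ^ K] digit vectors. If [K > N], the total [m ^ N] is
    already at most [m ^ K]. *)
Lemma card_low_weight (K : nat) :
  (\sum_(x < m ^ N) (digit_weight x N <= K) <= maxn 1 'C(N, K) * m ^ K)%N.
Proof.
case: (leqP K N) => [KN | NK]; last first.
  apply: (@leq_trans (m ^ N)).
    rewrite -[X in (_ <= X)%N](card_ord (m ^ N)) -sum1_card.
    by apply: leq_sum => x _; apply: leq_b1.
  by rewrite bin_small // mul1n leq_pexp2l // ltnW.
apply: (@leq_trans ('C(N, K) * m ^ K)); last by rewrite leq_mul2r leq_maxr orbT.
pose z : 'I_m := Ordinal m_gt0.
pose B (T : {set 'I_N}) := [set g : {ffun 'I_N -> 'I_m} | z.-support g \subset T].
have cB T : #|B T| = (m ^ #|T|)%N.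
  rewrite cardsE -[X in (X ^ _)%N]card_ord -(card_pffun_on z).
  by apply: eq_card => g; apply/idP/pffun_onP => [sT|[]//]; split=> // ?.
pose A := [set x : 'I_(m ^ N) | digit_weight x N <= K]%N.
have -> : (\sum_(x < m ^ N) (digit_weight x N <= K) = #|A|)%N.
  by rewrite -sum1_card [RHS]big_mkcond; apply: eq_bigr => x _; rewrite inE; case: leq.
rewrite -(card_imset _ (bij_inj code_digits_bij)).
pose P := [set T : {set 'I_N} | #|T| == K].
have -> : 'C(N, K) = #|P| by rewrite card_draws card_ord.
apply: (@leq_trans #|\bigcup_(T in P) B T|).
  apply/subset_leq_card/subsetP => _ /imsetP[x xA ->].
  have wx : (#|z.-support (code_digits x)| <= K)%N.
    move: xA; rewrite inE; apply: leq_trans.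
    rewrite /digit_weight -sum1_card big_mkcond /=; apply: leq_sum => i _.
    by rewrite !inE ffunE -val_eqE /=; case: eqP.
  have [|T sT cT] := @superset_card _ [set i in z.-support (code_digits x)] K.
    by rewrite cardsE wx card_ord.
  apply/bigcupP; exists T; rewrite inE ?cT //; apply: subset_trans sT.
  by apply/subsetP => i; rewrite inE.
apply: leq_trans (leq_card_bigcup _ _) _.
rewrite (eq_bigr (fun=> (m ^ K)%N)) ?sum_nat_const // => T.
by rewrite inE cB => /eqP->.
Qed.

End Digits.

(** * Program logic with a query counter *)

Section Wp.

Variables (F : finFieldType) (N : nat) (f : {ffun 'I_N -> F} -> F).

(* The second argument of [Q] is the total number of queries made so far. *)
Definition wp (c : prog F) (Q : state F -> nat -> Prop) (s : state F) (n : nat) :=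
  exists s' k, exec f c s s' k /\ Q s' (n + k)%N.

Implicit Type Q : state F -> nat -> Prop.

Lemma wp_skip Q s n : Q s n -> wp (Skip F) Q s n.
Proof. by move=> H; exists s, 0%N; rewrite addn0; split=> //; constructor. Qed.

Lemma wp_set_reg Q x e s n :
  Q (set_reg s x (neval s e)) n -> wp (SetReg F x e) Q s n.
Proof. by move=> H; eexists _, 0%N; rewrite addn0; split; first constructor. Qed.

Lemma wp_set_cell Q i e s n :
  Q (set_cell s (neval s i) (feval s e)) n -> wp (SetCell i e) Q s n.
Proof. by move=> H; eexists _, 0%N; rewrite addn0; split; first constructor. Qed.

Lemma wp_query Q i s n :
  Q (set_cell s (neval s i) (f (query_point N s))) n.+1 -> wp (Query F i) Q s n.
Proof. by move=> H; eexists _, 1%N; rewrite addn1; split; first constructor. Qed.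

Lemma wp_seq Q c1 c2 s n : wp c1 (wp c2 Q) s n -> wp (Seq c1 c2) Q s n.
Proof.
move=> [s1 [k1 [E1 [s2 [k2 [E2 HQ]]]]]]; exists s2, (k1 + k2)%N.
by rewrite addnA; split=> //; apply: ExecSeq E1 E2.
Qed.

Lemma wp_if Q b c1 c2 s n :
  (if teval s b then wp c1 Q s n else wp c2 Q s n) -> wp (If b c1 c2) Q s n.
Proof.
case: (boolP (teval s b)) => hb [s' [k [E HQ]]]; exists s', k; split=> //.
  exact: ExecIfTrue.
exact: ExecIfFalse.
Qed.

(** The number [K] of iterations is fixed in advance and [j] counts those done, so termination comes
    with the invariant. *)
Lemma wp_while (I : nat -> state F -> nat -> Prop) (K : nat) Q b c s n :
    (forall j s n, (j <= K)%N -> I j s n -> teval s b = (j < K)%N) ->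
    (forall j s n, (j < K)%N -> I j s n -> wp c (I j.+1) s n) ->
    (forall s n, I K s n -> Q s n) ->
  I 0%N s n -> wp (While b c) Q s n.
Proof.
(* Induction on the number [d] of remaining iterations, the current index being [K - d]. *)
move=> Hb Hc HQ; rewrite -(subnn K).
have : (K <= K)%N by []; move: {1 4}K => d.
elim: d s n => [|d IH] s n dK Is.
  rewrite subn0 in Is; exists s, 0%N; rewrite addn0; split; last exact: HQ.
  by apply: ExecWhileFalse; rewrite (Hb _ _ _ _ Is) ?ltnn.
have lt : (K - d.+1 < K)%N by rewrite ltn_subrL (leq_trans _ dK).
have [s1 [k1 [E1]]] := Hc _ _ _ lt Is.
rewrite subnSK // => /(IH _ _ (ltnW dK)) [s2 [k2 [E2 Q2]]].
exists s2, (k1 + k2)%N; rewrite addnA; split=> //.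
by apply: ExecWhileTrue E1 E2; rewrite (Hb _ _ _ _ Is) // ltnW.
Qed.

End Wp.

(** * The testing program and its correctness *)

Section Program.

Variable F : finFieldType.

(** A table lookup unrolled into comparisons; smaller indices being excluded already, [TLeq] acts as
    an equality test. *)
Fixpoint set_cell_nth (r i : nat) (l : seq F) (k : nat) : prog F :=
  if l is a :: l' then
    If (TLeq _ (NReg r) (NConst k)) (SetCell (NReg i) (FConst a))
       (set_cell_nth r i l' k.+1)
  else Skip F.

Lemma wp_set_cell_nth (N : nat) (f : {ffun 'I_N -> F} -> F)
    (Q : state F -> nat -> Prop) r i l k s n :
    (k <= reg s r < k + size l)%N ->
    Q (set_cell s (reg s i) l`_(reg s r - k)) n ->
  wp f (set_cell_nth r i l k) Q s n.
Proof.
elim: l k => [|a l IH] k /=; first by rewrite addn0; case: ltngtP.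
case/andP=> kr rk HQ; apply: wp_if => /=.
case: (leqP (reg s r) k) => rk'.
  apply: wp_set_cell => /=.
  by move: HQ; rewrite (_ : _ - k = 0)%N //; apply/eqP; rewrite subn_eq0.
apply: IH; first by rewrite rk' addSnnS.
by move: HQ; rewrite -(subnSK rk').
Qed.

Variable S : seq F.

Let m := size S.
Let q := #|F|.

(* Register 0 holds M and finally the answer, 1 holds N, 2 holds m ^ N, 3 is
   the index of a coordinate, 4 the current answer, 5 the code of the current
   point, 6 its undecoded part, 9 the current digit; when w nonzero digits have
   been met, 7 holds (q - 1) ^ w and 8 holds M * (q - 2) ^ w. *)

Local Notation "c1 ;; c2" := (Seq c1 c2) (at level 90, right associativity).

Definition power_prog : prog F :=
  SetReg F 2 (NConst 1);;
  SetReg F 3 (NConst 0);;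
  While (TNot (TLeq F (NReg 1) (NReg 3))) (
    SetReg F 2 (NMul (NReg 2) (NConst m));;
    SetReg F 3 (NAdd (NReg 3) (NConst 1))).

Definition decode_prog : prog F :=
  SetReg F 6 (NReg 5);;
  SetReg F 7 (NConst 1);;
  SetReg F 8 (NReg 0);;
  SetReg F 3 (NConst 0);;
  While (TNot (TLeq F (NReg 1) (NReg 3))) (
    SetReg F 9 (NMod (NReg 6) (NConst m));;
    set_cell_nth 9 3 S 0;;
    If (TLeq F (NReg 9) (NConst 0)) (Skip F) (
      SetReg F 7 (NMul (NReg 7) (NConst q.-1));;
      SetReg F 8 (NMul (NReg 8) (NConst q.-2)));;
    SetReg F 6 (NDiv (NReg 6) (NConst m));;
    SetReg F 3 (NAdd (NReg 3) (NConst 1))).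

(* The answer to the query goes to the cell N, next to the query point. *)
Definition query_prog : prog F :=
  If (TLeq F (NReg 7) (NReg 8)) (
    Query F (NReg 1);;
    If (TFEq (FCell F (NReg 1)) (FConst 0)) (Skip F) (SetReg F 4 (NConst 0)))
  (Skip F).

Definition vanishing_prog : prog F :=
  power_prog;;
  SetReg F 4 (NConst 1);;
  SetReg F 5 (NConst 0);;
  While (TNot (TLeq F (NReg 2) (NReg 5))) (
    decode_prog;;
    query_prog;;
    SetReg F 5 (NAdd (NReg 5) (NConst 1)));;
  SetReg F 0 (NReg 4).

Hypothesis m_gt0 : (0 < m)%N.
Variables (N M : nat) (f : {ffun 'I_N -> F} -> F).

(** Digit 0 selects the first element of [S], so code 0 is the base point. *)
Definition code_point (x : nat) : {ffun 'I_N -> F} :=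
  [ffun i : 'I_N => S`_(digit m x i)].

Lemma wp_power (Q : state F -> nat -> Prop) s n :
    reg s 0 = M -> reg s 1 = N ->
    (forall s', reg s' 0 = M -> reg s' 1 = N -> reg s' 2 = (m ^ N)%N -> Q s' n) ->
  wp f power_prog Q s n.
Proof.
move=> s0 s1 HQ; do 2 (apply/wp_seq/wp_set_reg => /=).
apply: (@wp_while _ _ _ (fun j s k => [/\ k = n, reg s 0 = M, reg s 1 = N,
          reg s 2 = (m ^ j)%N & reg s 3 = j]) N) => //.
- by move=> j t k _ [_ _ /= -> _ ->]; rewrite ltnNge.
- move=> j t k _ [? t0 t1 t2 t3].
  apply/wp_seq/wp_set_reg/wp_set_reg; split=> //=; last by rewrite t3 addn1.
  by rewrite t2 expnSr.
- by move=> t k [-> *]; apply: HQ.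
Qed.

Lemma wp_decode (Q : state F -> nat -> Prop) s n :
    reg s 0 = M -> reg s 1 = N ->
    (forall s', reg s' 0 = M -> reg s' 1 = N -> reg s' 2 = reg s 2 ->
       reg s' 4 = reg s 4 -> reg s' 5 = reg s 5 ->
       reg s' 7 = (q.-1 ^ digit_weight m (reg s 5) N)%N ->
       reg s' 8 = (M * q.-2 ^ digit_weight m (reg s 5) N)%N ->
       query_point N s' = code_point (reg s 5) ->
     Q s' n) ->
  wp f decode_prog Q s n.
Proof.
move=> s0 s1 HQ; do 4 (apply/wp_seq/wp_set_reg => /=).
pose x := reg s 5; pose w := digit_weight m x.
apply: (@wp_while _ _ _ (fun j t k => [/\
  [/\ k = n, reg t 0 = M & reg t 1 = N],
  [/\ reg t 2 = reg s 2, reg t 4 = reg s 4 & reg t 5 = x],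
  [/\ reg t 3 = j & reg t 6 = x %/ m ^ j]%N,
  [/\ reg t 7 = (q.-1 ^ w j)%N & reg t 8 = (M * q.-2 ^ w j)%N]
  & forall i, (i < j)%N -> cell t i = S`_(digit m x i)]) N).
- by move=> j t k _ [[_ _ /= ->] _ [-> _] _ _]; rewrite ltnNge.
- move=> j t k _ [[-> t0 t1] [t2 t4 t5] [t3 t6] [t7 t8] tc].
  have wS : w j.+1 = (w j + (digit m x j != 0))%N.
    by rewrite /w /digit_weight big_ord_recr.
  apply/wp_seq/wp_set_reg/wp_seq/wp_set_cell_nth => /=.
    by rewrite ltn_pmod.
  have cellS i : (i < j.+1)%N -> [eta cell t with j |-> S`_(digit m x j)] i = S`_(digit m x i).
    by rewrite ltnS /=; case: eqP => [-> //|/eqP ij] ji; apply: tc; rewrite ltn_neqAle ij.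
  have dj : (x %/ m ^ j %% m)%N = digit m x j by [].
  apply/wp_seq/wp_if => /=; rewrite subn0 t3 t6 dj leqn0.
  case: eqP => d0; [apply: wp_skip | apply/wp_seq/wp_set_reg/wp_set_reg];
    apply/wp_seq/wp_set_reg/wp_set_reg; split=> //=;
    rewrite ?t3 ?t6 ?t7 ?t8 ?addn1 ?wS ?d0 ?addn0 ?expnSr ?divnMA //.
  by rewrite (introN eqP d0) addn1 !expnSr mulnA.
- move=> t k [[-> t0 t1] [t2 t4 t5] [t3 t6] [t7 t8] tc].
  by apply: HQ => //; apply/ffunP => i; rewrite !ffunE tc.
- split=> //=; rewrite ?expn0 ?divn1 // /w /digit_weight big_ord0 ?muln1 //.
Qed.

(** The hypothesis turns the test on registers 7 and 8 into [digit_weight m x N <= K], and each code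
    passing it costs one query. *)
Lemma vanishing_prog_runs (K : nat) :
    (forall j, (q.-1 ^ j <= M * q.-2 ^ j)%N = (j <= K)%N) ->
  runs vanishing_prog M f
    [forall x : 'I_(m ^ N), (digit_weight m x N <= K)%N ==> (f (code_point x) == 0)]
    (\sum_(x < m ^ N) (digit_weight m x N <= K)%N).
Proof.
move=> HK.
pose ok x := (digit_weight m x N <= K)%N ==> (f (code_point x) == 0).
pose cnt x := (\sum_(y < x) (digit_weight m y N <= K)%N)%N.
suff [s' [k [E [ek ea]]]] : wp f vanishing_prog (fun s k => k = cnt (m ^ N)%N /\
   [forall x : 'I_(m ^ N), ok x] = (reg s 0 != 0%N)) (init_state F M N) 0.
  by exists s'; rewrite -ea -[X in exec _ _ _ _ X]ek.
apply/wp_seq/wp_power => // s s0 s1 s2.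
do 2 (apply/wp_seq/wp_set_reg => /=); apply/wp_seq.
(* Before round [x], exactly the codes below [x] have been treated, and register 4 is nonzero iff no
   nonzero value was met. *)
apply: (@wp_while _ _ _ (fun x t k => [/\ k = cnt x,
  [/\ reg t 0 = M, reg t 1 = N, reg t 2 = (m ^ N)%N & reg t 5 = x]
  & (reg t 4 != 0%N) = [forall y : 'I_x, ok y]]) (m ^ N)%N).
- by move=> j t k _ [_ [_ _ /= -> ->] _]; rewrite ltnNge.
- move=> x t k _ [-> [t0 t1 t2 t5] t4].
  have okS : [forall y : 'I_x.+1, ok y] = [forall y : 'I_x, ok y] && ok x.
    apply/forallP/andP => [H|[/forallP H Hx] y].
      split; last exact: (H ord_max).
      by apply/forallP => y; apply: (H (widen_ord (leqnSn x) y)).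
    have := ltn_ord y; rewrite ltnS leq_eqVlt => /orP[/eqP->//|yx].
    exact: (H (Ordinal yx)).
  have cntS : cnt x.+1 = (cnt x + (digit_weight m x N <= K))%N.
    by rewrite /cnt big_ord_recr.
  apply/wp_seq/wp_decode => // u; rewrite t5 => u0 u1 u2 u4 u5 u7 u8 uq.
  apply/wp_seq/wp_if => /=; rewrite u7 u8 HK.
  case wK: (_ <= K)%N; last first.
    apply/wp_skip/wp_set_reg; split=> //=.
    + by rewrite cntS wK addn0.
    + by rewrite u2 t2 u5 addn1; split.
    + by rewrite u4 t4 okS /ok wK andbT.
  apply/wp_seq/wp_query/wp_if => /=; rewrite eqxx uq.
  case: eqP => fx; [apply/wp_skip/wp_set_reg | apply/wp_set_reg/wp_set_reg];
    split=> //=; rewrite ?cntS ?wK ?addn1 // ?u2 ?u5 ?addn1 //.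
  + by rewrite u4 t4 okS /ok wK fx eqxx andbT.
  + by rewrite okS /ok wK (introF eqP fx) andbF.
- move=> t k [-> [t0 t1 t2 t5] t4]; apply: wp_set_reg; split=> //=.
- split=> //=; first by rewrite /cnt big_ord0.
  by apply/esym/forallP; case.
Qed.

End Program.

(** * Correctness of the decision and the query bound *)

Theorem corollary4p1 (R : realType) (F : finFieldType) (hq : (2 < #|F|)%N)
    (S : {set F}) (hS : S \subset [set~ 0]) :
  let t : R := (#|F|%:R - 1) / (#|F|%:R - 2%:R) in
  exists c : prog F,
  forall (M N : nat) (p : {mpoly F[N]}),
    (0 < M)%N -> (0 < N)%N -> (size (msupp p) <= M)%N ->
    exists (ans : bool) (n : nat),
      [/\ runs c M (black_box p) ans n,
          ans <-> (forall s : 'I_N -> F, (forall i, s i \in S) -> p.@[s] = 0)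
        & (n <= maxn 1 'C(N, floor_log t M%:R) * #|S| ^ floor_log t M%:R)%N].
Proof.
move=> t; have S0 a : a \in S -> a != 0 by move/(subsetP hS); rewrite !inE.
have [S_empty | [a aS]] := set_0Vmem S.
  (* Without a base point in [S], the answer is yes with no query: [S]^N is empty because N > 0. *)
  exists (SetReg F 0 (NConst 1)) => M N p _ N0 _; exists true, 0; split=> //.
    by eexists; split; first exact: ExecSetReg.
  by split=> // _ s /(_ (Ordinal N0)); rewrite S_empty inE.
pose l := enum S; have sl : size l = #|S| by rewrite -cardE.
have l0 : (0 < size l)%N by rewrite sl; apply/card_gt0P; exists a.
exists (vanishing_prog l) => M N p M0 N0 pM.
set K := floor_log t M%:R.
have HK j : (#|F|.-1 ^ j <= M * #|F|.-2 ^ j)%N = (j <= K)%N.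
  by rewrite leq_floor_log_nat.
have lS k : (k < size l)%N -> l`_k \in S by move/(mem_nth 0); rewrite mem_enum.
eexists _, _; split; first exact: (vanishing_prog_runs l0 _ HK); last first.
  by rewrite -sl; apply: card_low_weight.
split=> [/forallP H s sS | H]; last first.
  apply/forallP => x; apply/implyP => _; apply/eqP/H => i.
  by rewrite ffunE lS // ltn_pmod.
apply/eqP; apply: contraT => ps.
have a0 (i : 'I_N) : l`_0 != 0 :> F by exact/S0/lS.
have [E [Esize pE]] :=
  sparse_nonvanishing_near a0 (fun i => S0 _ (sS i)) ps.
have sl' i : (index (s i) l < size l)%N by rewrite index_mem mem_enum.
(* The digits of the mixed point: positions in [l] of the [s i] on [E], and 0 elsewhere; [h g] is
   its code. *)
pose g : {ffun 'I_N -> 'I_(size l)} :=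
  [ffun i => if i \in E then Ordinal (sl' i) else Ordinal l0].
have [h _ hK] := code_digits_bij l0 N.
have hg (i : 'I_N) : digit (size l) (h g) i = g i.
  by have /ffunP/(_ i) := hK g; rewrite ffunE => <-.
have wE : (digit_weight (size l) (h g) N <= #|E|)%N.
  rewrite /digit_weight -sum1_card [X in (_ <= X)%N]big_mkcond /=.
  by apply: leq_sum => i _; rewrite hg ffunE; case: ifP => // _; case: (_ != _).
(* By [HK] and [pM], the bound on [#|E|] gives [#|E| <= K], so this point was queried. *)
have := H (h g); rewrite (leq_trans wE) /=; last first.
  by rewrite -HK; apply: leq_trans Esize _; rewrite leq_mul2r pM orbT.
rewrite /black_box (meval_eq (v2 := fun i => if i \in E then s i else l`_0)).
  by rewrite (negPf pE).
move=> i; rewrite ffunE hg ffunE; case: ifP => //= _.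
by rewrite nth_index ?mem_enum.
Qed.
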